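(* Let $k\in\mathbb{N}$ and let $X_1,\ldots,X_k$ be independent random variables, each having the gamma distribution with parameters $1,1$ (i.e. density $e^{-x}$ for $x\ge 0$). Then for every integer $n\ge 0$, \[ E\big[(X_1+2X_2+\cdots+kX_k-k)^n\big]=\sum_{l_1+\cdots+l_k=n}\binom{n}{l_1,\ldots,l_k}\, d_{l_1}\, d_{l_2}(2)\cdots d_{l_k}(k), \] where the sum is over all $k$-tuples of nonnegative integers summing to $n$.
   Context: The derangement polynomials $d_n(x)$ are defined by $\frac{1}{1-xt}e^{-t}=\sum_{n=0}^\infty d_n(x)\frac{t^n}{n!}$, and $d_n=d_n(1)$ is the $n$-th derangement number (the number of fixed-point-free permutations of an $n$-element set). $\binom{n}{l_1,\ldots,l_k}=\frac{n!}{l_1!\cdots l_k!}$ is the multinomial coefficient. *)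

(* Defs.v *)
From mathcomp Require Import all_boot all_order all_algebra.
From mathcomp Require Import all_classical all_reals all_analysis measurable_realfun.
From mathcomp Require Import ring lra.

Set Implicit Arguments.
Unset Strict Implicit.
Unset Printing Implicit Defensive.

Import Order.TTheory GRing.Theory Num.Theory.
Import numFieldNormedType.Exports.

Local Open Scope classical_set_scope.
Local Open Scope ring_scope.

Definition gamma_fun (R : realType) (a : R) : R :=
  Rintegral lebesgue_measure `]0%R, +oo[ (fun t => t `^ (a - 1) * expR (- t)).

(* b is the rate parameter. *)
Definition gamma_pdf (R : realType) (a b x : R) : R :=
  if 0 <= x then b * expR (- (b * x)) * (b * x) `^ (a - 1) / gamma_fun a
  else 0.

Definition has_gamma_distribution (d : measure_display) (T : measurableType d)
    (R : realType) (P : probability T R) (X : {RV P >-> R}) (a b : R) : Prop :=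
  forall A : set R, measurable A ->
    distribution P X A =
    (\int[lebesgue_measure]_(x in A) (gamma_pdf a b x)%:E)%E.

Definition mutually_independent (d : measure_display) (T : measurableType d)
    (R : realType) (P : probability T R) (I : finType) (X : I -> {RV P >-> R}) :
    Prop :=
  forall (J : {set I}) (A : I -> set R), (forall i, measurable (A i)) ->
    P [set w | forall i, i \in J -> A i (X i w)] =
    (\prod_(i in J) P (X i @^-1` A i))%E.

(* The identity 1 / (1 - x t) * e^(- t) = \sum_n d_n(x) t^n / n!, understood
   for each real x as convergence of the series to the left-hand side for all t
   in some neighbourhood of 0.  It determines d uniquely. *)
Definition derangement_egf (R : realType) (d : nat -> {poly R}) : Prop :=
  forall x : R, \forall t \near (0 : R),
    series (fun n => (d n).[x] * t ^+ n / n`!%:R) @ \oo -->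
    1 / (1 - x * t) * expR (- t).

Lemma gamma_pdf11 (R : realType) (x : R) :
  gamma_pdf 1 1 x = if 0 <= x then expR (- x) else 0.
Proof.
suff g1 : gamma_fun (1 : R) = 1.
  by rewrite /gamma_pdf g1 subrr powRr0 divr1 mulr1 !mul1r.
rewrite /gamma_fun /Rintegral subrr.
transitivity (fine (\int[lebesgue_measure]_(t in [set` `]0%R, +oo[])
    (exponential_pdf (1 : R) t)%:E)).
  congr fine; apply: eq_integral => t; rewrite inE/= in_itv/= andbT => t0.
  by rewrite powRr0 mul1r exponential_pdfE ?ltW// mul1r mulN1r.
rewrite integral_itv_obnd_cbnd; last first.
  by apply/measurable_EFinP/measurable_funTS; exact: measurable_exponential_pdf.
transitivity (fine (1 : \bar R)) => //; congr fine.
rewrite integral_mkcond -(@integral_exponential_pdf R 1 ltr01).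
apply: eq_integral => t _; rewrite patchE /exponential_pdf patchE.
by case: (t \in _).
Qed.

Lemma derangement_egf_exists (R : realType) :
  exists d : nat -> {poly R}, derangement_egf d.
Proof.
pose d := fix d n : {poly R} :=
  if n is m.+1 then n%:R * 'X * d m + (-1) ^+ n else 1.
exists d => x.
have H : \forall t \near (0 : R), `|x * t| <= 2^-1.
  have c : (fun t : R => x * t) @ (0 : R) --> (0 : R).
    by rewrite -[X in _ --> X](mulr0 x); apply: cvgM; [exact: cvg_cst|exact: cvg_id].
  move/cvgrPdist_le : c => /(_ 2^-1); rewrite invr_gt0 ltr0n => /(_ isT).
  by apply: filterS => t; rewrite sub0r normrN.
apply: filterS H => t xt.
pose a n := (d n).[x] * t ^+ n / n`!%:R.
rewrite -/a.
have aS n : a n.+1 = x * t * a n + exp_coeff (- t) n.+1.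
  have dS : (d n.+1).[x] = n.+1%:R * x * (d n).[x] + (-1) ^+ n.+1.
    rewrite /= hornerD -polyC1 -polyCN -polyC_exp hornerC -mulrA.
    by rewrite !mulr_natl hornerMn hornerM hornerX mulrnAl.
  rewrite /a dS /exp_coeff /= factS natrM (exprNn t) !exprS.
  have nz : (n.+1%:R : R) != 0 by rewrite pnatr_eq0.
  have fz : (n`!%:R : R) != 0 by rewrite pnatr_eq0 -lt0n fact_gt0.
  by field; rewrite fz -natr1 addrC in nz *; rewrite nz.
pose E n := series (exp_coeff (- t)) n.
have sS n : series a n.+1 = x * t * series a n + E n.+1.
  rewrite /E /series /= !big_nat_recl// mulr_sumr.
  rewrite [a 0%N](_ : _ = exp_coeff (- t) 0%N); last first.
    by rewrite /a /exp_coeff /= hornerC !expr0 mulr1.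
  by under eq_bigr do rewrite aS; rewrite big_split/= addrCA.
have cs : cvgn (series a).
  pose b n := `|a n|; apply: normed_cvg; change (cvgn (series b)).
  apply: nondecreasing_is_cvgn.
    by apply: nondecreasing_series => i _ _; exact: normr_ge0.
  exists (2 * expR `|t|) => _ [n _ <-].
  have Ele m : series (exp_coeff `|t|) m <= expR `|t|.
    apply: nondecreasing_cvgn_le; last exact: is_cvg_series_exp_coeff.
    by apply: nondecreasing_series => i _ _; exact: exp_coeff_ge0.
  case: n => [|n]; first by rewrite /series/= big_geq// mulr_ge0// expR_ge0.
  have mono : series b n <= series b n.+1.
    by apply: nondecreasing_series => [i _ _|]; [exact: normr_ge0|exact: leqnSn].
  suff : series b n.+1 <= 2^-1 * series b n + expR `|t| by lra.
  apply: le_trans (lerD (lexx _) (Ele n.+1)).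
  rewrite /series/= !big_nat_recl// mulr_sumr addrCA -big_split/=.
  rewrite {1}/b [a 0%N](_ : _ = 1); last by rewrite /a /= hornerC expr0 mulr1 divr1.
  rewrite [exp_coeff _ 0%N](_ : _ = 1); last by rewrite /exp_coeff/= expr0 divr1.
  rewrite normr1 lerD2l ler_sum// => i _.
  rewrite /b aS (le_trans (ler_normD _ _))// lerD//.
    by rewrite normrM ler_wpM2r.
  by rewrite /exp_coeff/= normrM normrX normrN normfV normr_nat.
have cE : E @ \oo --> expR (- t) by exact: is_cvg_series_exp_coeff.
have lS : limn (series a) = x * t * limn (series a) + expR (- t).
  apply: (@cvg_unique _ _ ((fun n => series a n.+1 : R) @ \oo)) => //.
    have : series a @ \oo --> limn (series a) by exact: cs.
    by rewrite -cvg_shiftS.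
  rewrite (_ : (fun n => _) = fun n => x * t * series a n + E n.+1); last first.
    exact/funext.
  apply: cvgD; first by apply: cvgM; [exact: cvg_cst|exact: cs].
  by move: cE; rewrite -cvg_shiftS.
have xt1 : 1 - x * t != 0.
  by move: xt; rewrite ler_norml => /andP[_ xt]; apply: lt0r_neq0; lra.
suff <- : limn (series a) = 1 / (1 - x * t) * expR (- t) by [].
by rewrite div1r; apply: (mulfI xt1); rewrite mulVKf// mulrBl mul1r {1}lS; ring.
Qed.

(* Main.v *)
(* Let L be the linear functional on polynomials with L(X^j) = j!.  It satisfies
   L(p) = p(0) + L(p'), so the numbers L((x X - 1)^n) obey the recurrence
   d_(n+1)(x) = (n+1) x d_n(x) + (-1)^(n+1) that the generating function, once
   multiplied by 1 - x t, imposes on the derangement polynomials; hence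
   d_n(x) = L((x X - 1)^n).  Since L(p) = E[p(X)] for X of law gamma(1, 1) and
   \sum_i i X_i - k = \sum_i (i X_i - 1), the theorem is the multinomial
   expansion combined with independence. *)
Require Import Defs.
From mathcomp Require Import all_boot all_order all_algebra.
From mathcomp Require Import all_classical all_reals all_analysis.
From mathcomp Require Import measurable_realfun ring lra.

Set Implicit Arguments.
Unset Strict Implicit.
Unset Printing Implicit Defensive.

Import Order.TTheory GRing.Theory Num.Theory.
Import numFieldNormedType.Exports.

Local Open Scope classical_set_scope.
Local Open Scope ring_scope.

(** * The multinomial expansion *)

(** Both sides are [n!] times the coefficient of [X^n] in the product of the exponentials
    [exp (a_i X)]: the left one by multiplying exponentials, the right one by distributing the
    product over the terms of each series. Truncating the series after degree [n] leaves this
    coefficient unchanged and keeps all exponents in ['I_n.+1]. *)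
Lemma multinomial_theorem (F : numFieldType) (k n : nat) (a : 'I_k -> F) :
  (\sum_(i < k) a i) ^+ n =
  \sum_(l : {ffun 'I_k -> 'I_n.+1} | (\sum_(i < k) l i == n)%N)
     n`!%:R / (\prod_(i < k) (l i)`!%:R) * \prod_(i < k) a i ^+ l i.
Proof.
have fnz j : j`!%:R != 0 :> F by rewrite pnatr_eq0 -lt0n fact_gt0.
(* truncated exponential series in x 'X *)
pose E (x : F) : {poly F} := \poly_(j < n.+1) (x ^+ j / j`!%:R).
(* Every [m] up to [n] is needed: coefficient [m] of a product involves all lower coefficients of
   the tail. The induction step is the binomial theorem. *)
have coefE s m : (m <= n)%N ->
    (\prod_(i <- s) E (a i))`_m = (\sum_(i <- s) a i) ^+ m / m`!%:R.
  elim: s m => [|i s IH] m mn.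
    by rewrite !big_nil coef1 expr0n; case: m {mn} => [|m]; rewrite ?mul0r ?divr1.
  rewrite !big_cons coefMr exprDn mulr_suml; apply: eq_bigr => j _.
  have jm : (j <= m)%N by rewrite -ltnS.
  rewrite coef_poly ltnS (leq_trans (leq_subr _ _) mn).
  rewrite IH ?(leq_trans jm)// -(bin_fact jm) !natrM -mulr_natr.
  have bnz : 'C(m, j)%:R != 0 :> F by rewrite pnatr_eq0 -lt0n bin_gt0.
  by field; rewrite !fnz bnz.
have := coefE (index_enum 'I_k) n (leqnn n).
move=> /(congr1 ( *%R^~ n`!%:R)) /=; rewrite divfK// => <-.
under eq_bigr do rewrite /E poly_def.
rewrite bigA_distr_bigA/= coef_sum mulr_suml [RHS]big_mkcond/=.
apply: eq_bigr => l _.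
have -> : \prod_(i < k) ((a i ^+ l i / (l i)`!%:R) *: 'X^(l i)) =
    (\prod_(i < k) (a i ^+ l i / (l i)`!%:R)) *: 'X^(\sum_(i < k) l i)
    :> {poly F}.
  by rewrite scaler_prod -expr_sum.
rewrite coefZ coefXn eq_sym; case: eqP => _; last by rewrite mulr0 mul0r.
by rewrite mulr1 big_split/= prodfV mulrC -mulrA; congr (_ * _); exact: mulrC.
Qed.

(** * The functional sending [X^j] to [j!] *)

Definition factorial_moment (R : realType) (p : {poly R}) : R :=
  \sum_(j < size p) p`_j * j`!%:R.

Lemma factorial_moment_wide (R : realType) (p : {poly R}) (n : nat) :
  (size p <= n)%N -> factorial_moment p = \sum_(j < n) p`_j * j`!%:R.
Proof.
move=> pn; rewrite /factorial_moment -(subnKC pn) big_split_ord/=.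
by rewrite [X in _ + X]big1 ?addr0// => i _; rewrite nth_default ?mul0r// leq_addr.
Qed.

Lemma factorial_momentZ (R : realType) (c : R) (p : {poly R}) :
  factorial_moment (c *: p) = c * factorial_moment p.
Proof.
rewrite (factorial_moment_wide (size_scale_leq c p)) mulr_sumr.
by apply: eq_bigr => j _; rewrite coefZ mulrA.
Qed.

(** An algebraic integration by parts: the term [p_(j+1) (j+1)!] on the left equals
    [((j+1) p_(j+1)) j!], the term of index [j] for the derivative. *)
Lemma factorial_moment_deriv (R : realType) (p : {poly R}) :
  factorial_moment p = p.[0] + factorial_moment p^`().
Proof.
(* One term beyond the size is included so that the constant term splits off even when [p = 0]. *)
rewrite (factorial_moment_wide (leqnSn (size p))) big_ord_recl /= mulr1.
rewrite horner_coef0; congr (_ + _).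
rewrite (@factorial_moment_wide _ _ (size p)); last first.
  exact: leq_trans (size_poly _ _) (leq_pred _).
apply: eq_bigr => j _; rewrite coef_deriv -[_ *+ j.+1]mulr_natr -mulrA -natrM.
by rewrite -factS.
Qed.

Lemma factorial_moment_affine_pow (R : realType) (x : R) (n : nat) :
  factorial_moment ((x *: 'X - 1) ^+ n.+1) =
  n.+1%:R * x * factorial_moment ((x *: 'X - 1) ^+ n) + (-1) ^+ n.+1.
Proof.
rewrite factorial_moment_deriv addrC; congr (_ + _); last first.
  by rewrite horner_exp !hornerE.
have d1 : (1 : {poly R})^`() = 0 by rewrite -polyC1 derivC.
rewrite -factorial_momentZ deriv_exp derivB derivZ derivX d1 subr0.
by rewrite -scalerAl mul1r -scaler_nat scalerA.
Qed.

(** * Uniqueness of power series coefficients and the derangement recurrence *)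

(** Convergence at a single [r > 0] bounds [|c n| r^n], so for [0 < t <= r / 2] the terms after the
    constant one add up to at most a constant times [t]. Since the whole series sums to 0, [|c 0|]
    is at most that multiple of [t], for [t] arbitrarily small. *)
Lemma powerseries_coef0_eq0 (R : realType) (c : nat -> R) :
  (\forall t \near (0 : R)^'+,
    series (fun n => c n * t ^+ n) @ \oo --> (0 : R)) ->
  c 0%N = 0.
Proof.
move=> c0.
have /filter_ex[r [r0 cr]] : \forall t \near (0 : R)^'+,
    0 < t /\ series (fun n => c n * t ^+ n) @ \oo --> (0 : R).
  by near=> t; split; near: t; [exact: nbhs_right_gt|exact: c0].
have {cr} /cvg_series_bounded [K [_ /(_ (K + 1))]] :
    cvgn (series (fun n => c n * r ^+ n)).
  by apply/cvg_ex; exists 0.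
(* Boundedness provides every number strictly above [K] as a bound; [K + 1] is one. *)
rewrite ltrDl ltr01 => /(_ isT) bK.
have cK n : `|c n| <= (K + 1) / r ^+ n.
  rewrite ler_pdivlMr ?exprn_gt0// -[r ^+ n]gtr0_norm ?exprn_gt0// -normrM.
  exact: bK.
have K0 : 0 <= K + 1 by apply: le_trans (bK 0%N _).
(* The constant is [(K + 1) / r] times 2, the sum of the geometric series of ratio [1/2] that
   dominates the powers of [t / r]. *)
have small t n : 0 < t -> t <= r / 2 ->
    `|c 0%N - series (fun n => c n * t ^+ n) n.+1| <= t * (2 * (K + 1) / r).
  move=> t0 tr; rewrite /series/= big_nat_recl// expr0 mulr1 opprD addNKr normrN.
  apply: le_trans (ler_norm_sum _ _ _) _.
  have: \sum_(0 <= i < n) `|c i.+1 * t ^+ i.+1| <=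
        \sum_(0 <= i < n) t * ((K + 1) / r * 2^-1 ^+ i).
    apply: ler_sum => i _; rewrite normrM normrX (gtr0_norm t0) exprS mulrCA.
    rewrite ler_pM2l//; apply: le_trans (ler_wpM2r _ (cK i.+1)) _.
      by rewrite exprn_ge0// ltW.
    have -> : (K + 1) / r ^+ i.+1 * t ^+ i = (K + 1) / r * (t / r) ^+ i.
      by rewrite exprS invfM expr_div_n mulrA -!mulrA [_ ^- i * _]mulrC.
    rewrite ler_wpM2l ?divr_ge0 ?(ltW r0)//.
    rewrite lerXn2r ?nnegrE ?divr_ge0 ?(ltW r0) ?(ltW t0)//.
    by rewrite ler_pdivrMr// mulrC.
  move=> /le_trans; apply; rewrite -mulr_sumr ler_pM2l//.
  have := @geometric_seriesE R ((K + 1) / r) 2^-1.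
  rewrite /series /geometric /= => /(_ _) /(congr1 (fun f => f n)) /= ->; last first.
    by apply/eqP; lra.
  rewrite (_ : 1 - 2^-1 = 2^-1) ?invrK; last by lra.
  rewrite [leRHS](_ : _ = (K + 1) / r * 1 * 2); last by field; rewrite gt_eqF.
  rewrite ler_wpM2r// ler_wpM2l ?divr_ge0// ?(ltW r0)// lerBlDr lerDl.
have le0 : \forall t \near (0 : R)^'+, `|c 0%N| <= t * (2 * (K + 1) / r).
  near=> t.
  have ct : series (fun n => c n * t ^+ n) @ \oo --> (0 : R) by near: t.
  have {}ct : (fun n => c 0%N - series (fun n => c n * t ^+ n) n.+1) @ \oo -->
      c 0%N - 0.
    by apply: cvgB; [exact: cvg_cst|rewrite cvg_shiftS].
  have {ct} := @cvg_norm _ _ _ _ _ _ _ ct; rewrite subr0 => /(_ _) ct.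
  rewrite -(cvg_lim _ ct)//; apply: limr_le.
    by apply/cvg_ex; eexists; exact: ct.
  near=> n; apply: small; near: t; [exact: nbhs_right_gt|apply: nbhs_right_le].
  by rewrite divr_gt0.
apply/eqP; rewrite -normr_le0.
have ct : t * (2 * (K + 1) / r) @[t --> (0 : R)^'+] --> 0 * (2 * (K + 1) / r).
  by apply: cvg_at_right_filter; apply: cvgM; [exact: cvg_id|exact: cvg_cst].
rewrite mul0r in ct.
rewrite -(cvg_lim _ ct)//; apply: limr_ge => //.
by apply/cvg_ex; eexists; exact: ct.
Unshelve. all: by end_near. Qed.

(** Once [c 0 = 0], dividing by [t] gives the series of the shifted sequence, again of sum 0, so
    induction on [n] for all sequences applies. The neighbourhood is punctured to permit this
    division. *)
Lemma powerseries_eq0 (R : realType) (c : nat -> R) :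
  (\forall t \near (0 : R)^'+,
    series (fun n => c n * t ^+ n) @ \oo --> (0 : R)) ->
  forall n, c n = 0.
Proof.
move=> c0 n; elim: n c c0 => [c /powerseries_coef0_eq0//|n IH c c0].
apply: (IH (fun n => c n.+1)).
have c00 := powerseries_coef0_eq0 c0.
near=> t.
have t0 : 0 < t by near: t; exact: nbhs_right_gt.
have ct : series (fun n => c n * t ^+ n) @ \oo --> (0 : R) by near: t.
rewrite -cvg_shiftS in ct.
rewrite (_ : series _ =
    fun m => t^-1 * series (fun n => c n * t ^+ n) m.+1); last first.
  apply/funext => m; rewrite /series/= big_nat_recl// c00 mul0r add0r mulr_sumr.
  by apply: eq_bigr => i _; rewrite exprS mulrCA mulKf// gt_eqF.
by rewrite -(mulr0 t^-1); apply: cvgM => //; exact: cvg_cst.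
Unshelve. all: by end_near. Qed.

Lemma derangement_poly_rec (R : realType) (d : nat -> {poly R}) (x : R) :
  derangement_egf d -> (d 0%N).[x] = 1 /\
  forall n, (d n.+1).[x] = n.+1%:R * x * (d n).[x] + (-1) ^+ n.+1.
Proof.
move=> /(_ x) hd.
(* coefficients of (1 - x t) \sum_n d_n(x) t^n / n! - exp (- t) *)
pose c n := (d n).[x] / n`!%:R - (-1) ^+ n / n`!%:R -
  (if n is m.+1 then x * (d m).[x] / m`!%:R else 0).
have c0 : forall n, c n = 0.
  apply: powerseries_eq0; rewrite near_withinE; near=> t => t0.
  have sd : series (fun n => (d n).[x] * t ^+ n / n`!%:R) @ \oo -->
      1 / (1 - x * t) * expR (- t) by near: t.
  have se : series (exp_coeff (- t)) @ \oo --> expR (- t).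
    exact: is_cvg_series_exp_coeff.
  have xt1 : 1 - x * t != 0.
    have : `|x * t| < 1.
      near: t.
      have ct : (fun t : R => x * t) @ (0 : R) --> (0 : R).
        rewrite -[X in _ --> X](mulr0 x).
        by apply: cvgM; [exact: cvg_cst|exact: cvg_id].
      move/cvgrPdist_lt : ct => /(_ 1 ltr01); apply: filterS => t.
      by rewrite sub0r normrN.
    by move=> /ltr_normlW xt1; rewrite subr_eq0 gt_eqF.
  rewrite -cvg_shiftS /=.
  (* The last partial sum stops one index earlier because its factor [t] raises degrees by one; the
     combination is then exactly a partial sum of [c n * t ^+ n]. Its limit is 0 since [(1 - x t)]
     cancels. *)
  have : (fun n => series (fun n => (d n).[x] * t ^+ n / n`!%:R) n.+1
     - series (exp_coeff (- t)) n.+1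
     - x * t * series (fun n => (d n).[x] * t ^+ n / n`!%:R) n) @ \oo -->
     1 / (1 - x * t) * expR (- t) - expR (- t)
       - x * t * (1 / (1 - x * t) * expR (- t)).
    apply: cvgB; first by apply: cvgB; rewrite cvg_shiftS.
    by apply: cvgM => //; exact: cvg_cst.
  rewrite [X in _ --> X -> _](_ : _ = 0); last by field.
  rewrite [X in X @ _ --> _ -> _](_ : _ =
    fun n => series (fun n => c n * t ^+ n) n.+1) //.
  apply/funext => n.
  rewrite /series/= !big_nat_recl//= [X in _ = X]addrC mulr_sumr.
  rewrite [X in _ = X + _](_ : _ =
      \sum_(0 <= i < n) ((d i.+1).[x] * t ^+ i.+1 / i.+1`!%:R) -
      \sum_(0 <= i < n) (exp_coeff (- t) i.+1) -
      \sum_(0 <= i < n) (x * t * ((d i).[x] * t ^+ i / i`!%:R))).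
    by rewrite /c /exp_coeff/= fact0 !expr0; ring.
  rewrite -!sumrB; apply: eq_bigr => i _; rewrite /c /exp_coeff/=.
  by rewrite [(- t) ^+ _]exprNn [t ^+ i.+1]exprS; ring.
split.
  have := c0 0%N; rewrite /c fact0 expr0 !divr1 subr0.
  by move/eqP; rewrite subr_eq0 => /eqP.
move=> n; have := c0 n.+1; rewrite /c factS natrM => cn.
have fnz : n`!%:R != 0 :> R by rewrite pnatr_eq0 -lt0n fact_gt0.
have nnz : n.+1%:R != 0 :> R by rewrite pnatr_eq0.
(* The recurrence is [c n.+1 = 0] multiplied by the common denominator [(n+1)!]. *)
apply/eqP; rewrite -subr_eq0; apply/eqP.
transitivity ((n.+1%:R * n`!%:R) * 0 : R); last by rewrite mulr0.
by rewrite -cn; field; rewrite fnz addrC natr1 nnz.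
Unshelve. all: by end_near. Qed.

Lemma derangement_poly_factorial_moment (R : realType) (d : nat -> {poly R})
    (x : R) (n : nat) :
  derangement_egf d -> (d n).[x] = factorial_moment ((x *: 'X - 1) ^+ n).
Proof.
move=> /(@derangement_poly_rec _ _ x)[d0 dS].
elim: n => [|n IH]; last by rewrite dS factorial_moment_affine_pow IH.
by rewrite d0 expr0 /factorial_moment size_poly1 big_ord1 coef1 mul1r.
Qed.

(** * Change of variables with a weight *)

Section weighted_transfer.
Import HBNNSimple.

(** The hypothesis on sets is the claim for indicators; linearity extends it to simple functions and
    monotone convergence to every nonnegative measurable [f]. It serves twice: with [G] a product of
    random factors, to exploit independence, and with [G] a density and [Y] the identity, to compute
    moments. *)
Lemma ge0_integral_weighted_transfer (d1 d2 : measure_display)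
    (T1 : measurableType d1) (T2 : measurableType d2) (R : realType)
    (mu : {measure set T1 -> \bar R}) (nu : {measure set T2 -> \bar R})
    (G : T1 -> R) (Y : T1 -> T2) (f : T2 -> R) :
  measurable_fun setT G -> (forall x, 0 <= G x) -> measurable_fun setT Y ->
  (forall A, measurable A ->
    (\int[mu]_x (G x * \1_A (Y x))%:E = nu A)%E) ->
  measurable_fun setT f -> (forall y, 0 <= f y) ->
  (\int[mu]_x (G x * f (Y x))%:E = \int[nu]_y (f y)%:E)%E.
Proof.
move=> mG G0 mY GY mf f0.
have mfE : measurable_fun [set: T2] (EFin \o f) by exact/measurable_EFinP.
pose f_ := nnsfun_approx measurableT mfE.
have mGf n : measurable_fun setT (fun x => (G x * f_ n (Y x))%:E).
  apply/measurable_EFinP; apply: measurable_funM => //.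
  exact: measurableT_comp.
transitivity (limn (fun n => \int[mu]_x (G x * f_ n (Y x))%:E)%E).
  rewrite -monotone_convergence//=.
  - apply: eq_integral => x _; apply/esym/cvg_lim => //.
    under eq_fun do rewrite EFinM.
    rewrite EFinM; apply: cvgeZl => //.
    by apply: (cvg_nnsfun_approx measurableT mfE) => // *; rewrite lee_fin.
  - by move=> n x _; rewrite lee_fin mulr_ge0.
  - move=> x _ a b ab; rewrite lee_fin ler_wpM2l//.
    exact/lefP/nd_nnsfun_approx.
transitivity (limn (fun n => \int[nu]_y (f_ n y)%:E)%E); last first.
  rewrite -monotone_convergence//=.
  - apply: eq_integral => x _; apply/cvg_lim => //.
    by apply: (cvg_nnsfun_approx measurableT mfE) => // *; rewrite lee_fin.
  - by move=> n; exact/measurable_EFinP.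
  - by move=> n x _; rewrite lee_fin.
  - by move=> x _ a b ab; rewrite lee_fin; exact/lefP/nd_nnsfun_approx.
congr (limn _); apply/funext => n.
have mGi r : measurable_fun setT (fun x => (G x * \1_(f_ n @^-1` [set r]) (Y x))%:E).
  apply/measurable_EFinP; apply: measurable_funM => //.
  exact: measurableT_comp.
under [LHS]eq_integral.
  move=> x _; rewrite fimfunE mulr_fsumr//.
  under eq_fsbigr do rewrite mulrCA.
  rewrite -fsumEFin//; over.
under [RHS]eq_integral do rewrite fimfunE -fsumEFin//.
rewrite !ge0_integral_fsum//.
- apply: eq_fsbigr => r _.
  (* Pulling [r] out of the integrals requires [0 <= r]. A negative [r] has an empty fibre, as
     [f_ n] is nonnegative, and both sides vanish. *)
  have [r0|r0] := leP 0 r; last first.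
    have -> : f_ n @^-1` [set r] = set0.
      rewrite -subset0 => x /= fx.
      have : 0 <= r by rewrite -fx; exact: fun_ge0.
      by rewrite leNgt r0.
    by rewrite !integral0_eq// => x _; rewrite indic0 ?mulr0.
  under [LHS]eq_integral do rewrite EFinM.
  under [RHS]eq_integral do rewrite EFinM.
  rewrite !ge0_integralZl//.
  + by rewrite GY// integral_indic// setIT.
  + exact/measurable_EFinP.
  + by move=> x _; rewrite lee_fin mulr_ge0.
- by move=> r; apply/measurable_EFinP; apply: measurable_funM.
- by move=> r x _; rewrite EFinM nnfun_muleindic_ge0.
- move=> r; under eq_fun do rewrite EFinM.
  by apply: emeasurable_funM => //; exact: measurable_cst.
- move=> r x _; rewrite mulrCA lee_fin mulr_ge0//.
  have := @nnfun_muleindic_ge0 _ _ _ (f_ n) r (Y x).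
  by rewrite -EFinM lee_fin.
Qed.

End weighted_transfer.

(** * Factorials as integrals against the exponential density *)

(** For a monomial, [exp x >= x^(n+1) / (n+1)!] squeezes [x^n exp (- x)] between 0 and [(n+1)! / x];
    linearity does the rest. *)
Lemma cvgr_polyexpR (R : realType) (p : {poly R}) :
  p.[x] * expR (- x) @[x --> +oo] --> (0 : R).
Proof.
have XnE n : x ^+ n * expR (- x) @[x --> +oo] --> (0 : R).
  have x0 : (n.+1)`!%:R * x^-1 @[x --> +oo] --> (0 : R).
    rewrite -[X in _ --> X](mulr0 (n.+1)`!%:R); apply: cvgMl_tmp.
    by apply/gtr0_cvgV0; [exact: nbhs_pinfty_gt|exact: cvg_id].
  apply: (squeeze_cvgr _ (cvg_cst 0) x0).
  near=> x.
  have x0' : 0 < x by near: x; exact: nbhs_pinfty_gt.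
  rewrite mulr_ge0 ?expR_ge0 ?exprn_ge0 ?(ltW x0')//=.
  have := expR_ge1Dxn n (ltW x0'); rewrite expRN => H.
  rewrite ler_pdivrMr ?expR_gt0//.
  have fnz : 0 < (n.+1)`!%:R :> R by rewrite ltr0n fact_gt0.
  by rewrite mulrAC ler_pdivlMr// -exprSr mulrC -ler_pdivrMr//; lra.
under eq_fun do rewrite horner_coef mulr_suml.
elim: (index_enum _) => [|i s IH].
  by under eq_fun do rewrite big_nil; exact: cvg_cst.
under eq_fun do rewrite big_cons -mulrA.
have := cvgD (cvgMl_tmp (a := p`_i) (XnE i)) IH; rewrite mulr0 addr0; exact.
Unshelve. all: by end_near. Qed.

Lemma integral_Xn_expR (R : realType) (n : nat) :
  (\int[lebesgue_measure]_(x in `[0%R, +oo[) (x ^+ n * expR (- x))%:E =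
    n`!%:R%:E :> \bar R)%E.
Proof.
(* - q_n(x) exp (- x) is an antiderivative of x^n exp (- x) *)
pose q := fix q n : {poly R} := if n is m.+1 then 'X^n + n%:R *: q m else 1.
(* The derivative of [- q exp (- x)] is [(q - q') exp (- x)], so this identity makes [F] an
   antiderivative; the value [q_n(0) = n!] below becomes the integral. *)
have dq m : q m - (q m)^`() = 'X^m.
  elim: m => [|m IH]; first by rewrite /= -polyC1 derivC subr0.
  rewrite /= derivD derivXn derivZ opprD addrACA -scalerBr IH /=.
  by rewrite scaler_nat -addrA addNr addr0.
have q0 m : (q m).[0] = m`!%:R.
  elim: m => [|m IH]; first by rewrite /= hornerC.
  by rewrite /= hornerD hornerXn expr0n /= add0r hornerZ IH factS natrM.
pose F (x : R) := - ((q n).[x] * expR (- x)).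
have dF (x : R) : is_derive x 1 F (x ^+ n * expR (- x)).
  have dE : is_derive x 1 (fun y : R => expR (- y)) (- expR (- x)).
    have := @is_derive1_comp R expR -%R x _ _ (is_derive_expR _)
      (is_deriveNid _ _).
    by rewrite mulrN1.
  apply: (trigger_derive (is_deriveN (is_deriveM (is_derive_poly (q n) x) dE))).
  by rewrite -hornerXn -dq hornerD hornerN /GRing.scale/=; ring.
rewrite (@ge0_continuous_FTC2y _ _ F 0 0).
- by rewrite /F q0 oppr0 expR0 mulr1 sub0e EFinN oppeK.
- by move=> x x0; rewrite mulr_ge0 ?exprn_ge0 ?expR_ge0.
- apply: continuous_subspaceT => x; apply: cvgM; first exact: exprn_continuous.
  by apply: continuous_comp; [exact: opp_continuous|exact: continuous_expR].
- by rewrite -oppr0; apply: cvgN; exact: cvgr_polyexpR.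
- by move=> x _; have [] := dF x.
- apply: cvg_at_right_filter; apply: differentiable_continuous.
  by apply/derivable1_diffP; have [] := dF 0.
- by move=> x _; rewrite derive1E; have [_ ->] := dF x.
Qed.

(** * Expectation of a product of independent nonnegative factors *)

Section independence.
Context (R : realType) (disp : measure_display) (T : measurableType disp)
  (P : probability T R).

Lemma measurable_prod_RV (I : finType) (X : I -> {RV P >-> R})
    (g : I -> R -> R) (Q : pred I) :
  (forall i, measurable_fun [set: R] (g i)) ->
  measurable_fun [set: T] (fun w => \prod_(i | Q i) g i (X i w)).
Proof.
move=> mg.
rewrite (_ : (fun w => _) =
    fun w => \prod_(i <- index_enum I) if Q i then g i (X i w) else 1).
  apply: measurable_prod => i _; case: (Q i) => //.
  exact: measurableT_comp.
by apply/funext => w; rewrite big_mkcond.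
Qed.

(** Independence is the case of indicators, extended to general factors one index at a time. The
    means are given as reals [m i] so that the product of all but one of them can scale a
    measure. *)
Lemma ge0_expectation_prod (I : finType) (X : I -> {RV P >-> R})
    (g : I -> R -> R) (m : I -> R) :
  mutually_independent X ->
  (forall i, measurable_fun [set: R] (g i)) -> (forall i x, 0 <= g i x) ->
  (forall i, (\int[P]_w (g i (X i w))%:E = (m i)%:E)%E) ->
  (\int[P]_w (\prod_i g i (X i w))%:E = (\prod_i m i)%:E)%E.
Proof.
move=> indep.
suff H (s : seq I) : forall (g : I -> R -> R) (m : I -> R),
    (forall i, i \notin s -> exists2 A, measurable A & g i = \1_A) ->
    (forall i, measurable_fun [set: R] (g i)) -> (forall i x, 0 <= g i x) ->
    (forall i, (\int[P]_w (g i (X i w))%:E = (m i)%:E)%E) ->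
    (\int[P]_w (\prod_i g i (X i w))%:E = (\prod_i m i)%:E)%E.
  by apply: (H (index_enum I)) => i; rewrite mem_index_enum.
(* The factors outside s are indicators; they are turned into arbitrary g i one
   at a time, by applying the induction hypothesis with g j replaced by every
   indicator. *)
elim: s => [{}g {}m gA mg g0 gm|j s IH {}g {}m gA mg g0 gm].
  have /choice[A HA] : forall i, exists A, measurable A /\ g i = \1_A.
    by move=> i; have [A mA gi] := gA i isT; exists A.
  have mA i : measurable (A i) by have [] := HA i.
  have gE i x : g i x = \1_(A i) x by have [_ ->] := HA i.
  have mXA i : measurable (X i @^-1` A i).
    by rewrite -[X in measurable X]setTI; exact: measurable_funPT.
  (* With every factor an indicator, the integrand is the indicator of this intersection;
     independence is used with [J] the full index set. *)
  have PA : P (\big[setI/setT]_i (X i @^-1` A i)) =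
      (\prod_i P (X i @^-1` A i))%E.
    rewrite -[RHS](eq_bigl _ _ (fun i => finset.in_setT i)) -indep//.
    congr (P _); rewrite -bigcap_seq; apply/seteqP.
    by split => w /= H i _; apply: H; rewrite ?finset.in_setT//= mem_index_enum.
  rewrite -prodEFin.
  transitivity (\int[P]_w (\1_(\big[setI/setT]_i (X i @^-1` A i)) w)%:E)%E.
    apply: eq_integral => w _; congr EFin.
    rewrite (eq_bigr _ (fun i _ => gE i (X i w))).
    elim/big_rec2: _ => [|i B y _ ->]; first by rewrite indicT.
    by rewrite indicI.
  rewrite integral_indic ?setIT//; last exact: bigsetI_measurable.
  apply: (eq_trans PA); apply: eq_bigr => i _; rewrite -gm.
  under eq_integral do rewrite gE.
  by have := integral_indic P measurableT (mXA i); rewrite setIT => <-.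
pose G w := \prod_(i | i != j) g i (X i w).
have c0 : 0 <= \prod_(i | i != j) m i.
  apply: prodr_ge0 => i _; rewrite -lee_fin -gm.
  by apply: integral_ge0 => w _; rewrite lee_fin.
(* The law of [X j], scaled by the means of the other factors, is the image measure expected under
   the weight [G]. Checking this on a set [A] means replacing [g j] by [\1_A], which leaves only
   indices of [s] to treat. *)
pose nu := mscale (NngNum c0) (distribution P (X j)).
transitivity (\int[P]_w (G w * g j (X j w))%:E)%E.
  by apply: eq_integral => w _; rewrite (bigD1 j)//= mulrC.
rewrite (@ge0_integral_weighted_transfer _ _ _ _ _ _ nu)//.
- rewrite ge0_integral_mscale//; last 2 first.
  + exact/measurable_EFinP.
  + by move=> x _; rewrite lee_fin.
  rewrite ge0_integral_distribution//; last 2 first.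
  + exact/measurable_EFinP.
  + by move=> x; rewrite lee_fin.
  by rewrite /= gm -EFinM [in RHS](bigD1 j)//= mulrC.
- exact: measurable_prod_RV.
- by move=> w; exact: prodr_ge0.
- move=> A mA.
  pose g' i := if i == j then \1_A else g i.
  pose m' i := if i == j then fine (P (X j @^-1` A)) else m i.
  have mXA : measurable (X j @^-1` A).
    by rewrite -[X in measurable X]setTI; exact: measurable_funPT.
  have nuA : nu A = (\prod_i m' i)%:E.
    rewrite /nu /mscale/= [X in _ = X%:E](bigD1 j)//= /m' eqxx mulrC EFinM.
    rewrite fineK ?fin_num_measure//.
    by congr ((_%:E * _)%E); apply: eq_bigr => i /negbTE ->.
  apply: eq_trans (esym nuA); rewrite -(IH g' m').
  + apply: eq_integral => w _; rewrite [in RHS](bigD1 j)//= /g' eqxx mulrC.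
    by congr ((_ * _)%:E); apply: eq_bigr => i /negbTE ->.
  + move=> i si; rewrite /g'; case: eqP => [_|/eqP ij]; first by exists A.
    by apply: gA; rewrite inE negb_or ij.
  + by move=> i; rewrite /g'; case: eqP.
  + by move=> i x; rewrite /g'; case: eqP.
  + move=> i; rewrite /g' /m'; case: eqP => // ->.
    rewrite fineK ?fin_num_measure//.
    by have := integral_indic P measurableT mXA; rewrite setIT => <-.
Qed.

End independence.

(** * Polynomial expectations for independent gamma(1, 1) variables *)

Section gamma11.
Context (R : realType) (disp : measure_display) (T : measurableType disp)
  (P : probability T R).

(** Absolute values keep the integrand nonnegative on the whole line, as the transfer lemma
    requires; they change nothing where the density is nonzero, so the integral of [x^n exp (- x)]
    remains. *)
Lemma gamma11_abs_moment (X : {RV P >-> R}) (n : nat) :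
  has_gamma_distribution X 1 1 ->
  (\int[P]_w (`|X w| ^+ n)%:E = n`!%:R%:E)%E.
Proof.
move=> HX.
have pdfE x : gamma_pdf 1 1 x = exponential_pdf 1 x :> R.
  rewrite gamma_pdf11 /exponential_pdf patchE mem_setE in_itv/= andbT.
  by rewrite mul1r mulN1r.
have mpdf : measurable_fun [set: R] (gamma_pdf 1 1 : R -> R).
  by rewrite (funext pdfE); exact: measurable_exponential_pdf.
have mXn : measurable_fun [set: R] (fun x => `|x| ^+ n).
  by apply: measurable_funX; exact: normr_measurable.
rewrite -(@ge0_integral_distribution _ _ _ _ _ _ X (fun x => (`|x| ^+ n)%:E))//;
  last exact/measurable_EFinP.
have := @ge0_integral_weighted_transfer _ _ _ _ _ lebesgue_measure
  (distribution P X) (gamma_pdf 1 1) id (fun x => `|x| ^+ n).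
move=> <-//; last 2 first.
- by move=> x; rewrite gamma_pdf11; case: ifP => // _; exact: expR_ge0.
- move=> A mA; rewrite -[RHS]/(distribution P X A) HX// [RHS]integral_mkcond.
  apply: eq_integral => x _; rewrite patchE indicE.
  by case: (x \in A); rewrite ?mulr1 ?mulr0.
rewrite -integral_Xn_expR [RHS]integral_mkcond; apply: eq_integral => x _.
rewrite patchE mem_setE in_itv/= andbT gamma_pdf11; case: ifPn => [x0|_].
  by rewrite ger0_norm// mulrC.
by rewrite mul0r.
Qed.

Lemma gamma11_ae_ge0 (X : {RV P >-> R}) :
  has_gamma_distribution X 1 1 -> {ae P, forall w, 0 <= X w}.
Proof.
move=> HX; exists (X @^-1` `]-oo, 0[); split.
- by rewrite -[X in measurable X]setTI; exact: measurable_funPT.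
- rewrite -[LHS]/(distribution P X _) HX//; apply: integral0_eq => x /=.
  by rewrite in_itv/= gamma_pdf11 => x0; rewrite leNgt x0.
- by move=> w /= /negP; rewrite -ltNge in_itv.
Qed.

(** The product expands into monomials. Absolute moments give the integrability of each, and almost
    sure nonnegativity removes the absolute values from its integral. Integrability is part of the
    conclusion so that finite sums of such products can be integrated termwise. *)
Lemma expectation_prod_horner_gamma11 (I : finType) (X : I -> {RV P >-> R})
    (p : I -> {poly R}) :
  mutually_independent X ->
  (forall i, has_gamma_distribution (X i) 1 1) ->
  ('E_P[(fun w => \prod_i (p i).[X i w])%R])%E =
    (\prod_i factorial_moment (p i))%:E /\
  P.-integrable setT (EFin \o fun w => \prod_i (p i).[X i w]).
Proof.
move=> indep HX.
have mon (e : I -> nat) :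
    (\int[P]_w (\prod_i X i w ^+ e i)%:E = (\prod_i (e i)`!%:R)%:E)%E /\
    P.-integrable setT (fun w => (\prod_i X i w ^+ e i)%:E).
  have mprod : measurable_fun setT (fun w => (\prod_i X i w ^+ e i)%:E).
    apply/measurable_EFinP.
    apply: (@measurable_prod_RV _ _ _ _ _ X (fun i x => x ^+ e i) xpredT) => i.
    exact: measurable_funX.
  have abs : (\int[P]_w (\prod_i `|X i w| ^+ e i)%:E =
      (\prod_i (e i)`!%:R)%:E)%E.
    apply: (@ge0_expectation_prod _ _ _ _ _ X (fun i x => `|x| ^+ e i)) => //.
    - by move=> i; apply: measurable_funX; exact: normr_measurable.
    - by move=> i; exact: gamma11_abs_moment.
  have mabs : measurable_fun setT (fun w => (\prod_i `|X i w| ^+ e i)%:E).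
    apply/measurable_EFinP.
    apply: (@measurable_prod_RV _ _ _ _ _ X (fun i x => `|x| ^+ e i) xpredT) => i.
    by apply: measurable_funX; exact: normr_measurable.
  split.
    rewrite -abs; apply: ae_eq_integral => //.
    (* The finitely many exceptional null sets combine into one, outside which all [X i] are
       nonnegative. *)
    have /filter_forall : forall i, \forall w \ae P, 0 <= X i w.
      by move=> i; exact: gamma11_ae_ge0.
    apply: filterS => w X0 _; congr EFin; apply: eq_bigr => i _.
    by rewrite ger0_norm.
  apply/integrableP; split => //.
  rewrite (eq_integral (fun w => (\prod_i `|X i w| ^+ e i)%:E)) ?abs ?ltry//.
  move=> w _ /=; rewrite normr_prod; congr EFin; apply: eq_bigr => i _.
  by rewrite normrX.
(* A common bound on the sizes lets all polynomials be summed over the same ['I_N], so that the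
   product of sums becomes a sum over functions. *)
pose N := \max_i size (p i).
have pE w : \prod_i (p i).[X i w] = \sum_(f : {ffun I -> 'I_N})
    (\prod_i (p i)`_(f i)) * \prod_i X i w ^+ f i.
  rewrite (eq_bigr (fun i => \sum_(j < N) (p i)`_j * X i w ^+ j)) => [|i _].
    by rewrite bigA_distr_bigA/=; apply: eq_bigr => f _; rewrite big_split.
  by apply: horner_coef_wide; exact: leq_bigmax.
have ip (f : {ffun I -> 'I_N}) : P.-integrable setT
    (fun w => ((\prod_i (p i)`_(f i)) * \prod_i X i w ^+ f i)%:E).
  under eq_fun do rewrite EFinM.
  by apply: integrableZl => //; exact: (mon _).2.
have sumE : (EFin \o fun w => \prod_i (p i).[X i w]) =
    fun w => (\sum_(f : {ffun I -> 'I_N})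
      ((\prod_i (p i)`_(f i)) * \prod_i X i w ^+ f i)%:E)%E.
  by apply/funext => w; rewrite /= pE sumEFin.
split; last by rewrite sumE; exact: integrable_sum.
rewrite unlock -[LHS]/(\int[P]_w (EFin \o (fun w => \prod_i (p i).[X i w])%R) w)%E.
rewrite sumE integral_sum//.
rewrite (eq_bigr (fun i => \sum_(j < N) (p i)`_j * j`!%:R)) => [|i _]; last first.
  by apply: factorial_moment_wide; exact: leq_bigmax.
rewrite bigA_distr_bigA/= -sumEFin; apply: eq_bigr => f _.
under eq_integral do rewrite EFinM.
by rewrite integralZl//= ?(mon _).1 ?big_split//; exact: (mon _).2.
Qed.

End gamma11.

Unset Implicit Arguments.
Set Strict Implicit.
Set Printing Implicit Defensive.

Theorem theorem8 (R : realType) (disp : measure_display)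
    (T : measurableType disp) (P : probability T R)
    (d : nat -> {poly R}) (hd : derangement_egf d)
    (k : nat) (X : 'I_k -> {RV P >-> R})
    (X_indep : mutually_independent X)
    (X_gamma : forall i : 'I_k, has_gamma_distribution (X i) 1 1)
    (n : nat) :
  ('E_P[(fun w => (\sum_(i < k) i.+1%:R * X i w - k%:R) ^+ n)%R])%E =
  (\sum_(l : {ffun 'I_k -> 'I_n.+1} | (\sum_(i < k) l i == n)%N)
     n`!%:R / (\prod_(i < k) (l i)`!%:R) *
     \prod_(i < k) (d (l i)).[i.+1%:R])%:E.
Proof.
(* Ordinals start at 0, so the variable of index [i] carries the weight [i.+1]; each factor takes
   one unit of the subtracted [k]. *)
pose p (l : {ffun 'I_k -> 'I_n.+1}) (i : 'I_k) : {poly R} :=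
  (i.+1%:R *: 'X - 1) ^+ l i.
pose c (l : {ffun 'I_k -> 'I_n.+1}) : R := n`!%:R / (\prod_(i < k) (l i)`!%:R).
have expand w : (\sum_(i < k) i.+1%:R * X i w - k%:R) ^+ n =
    \sum_(l : {ffun 'I_k -> 'I_n.+1} | (\sum_(i < k) l i == n)%N)
      c l * \prod_(i < k) (p l i).[X i w].
  have -> : k%:R = \sum_(i < k) (1 : R) by rewrite sumr_const card_ord.
  rewrite -sumrB multinomial_theorem; apply: eq_bigr => l _; congr (_ * _).
  by apply: eq_bigr => i _; rewrite horner_exp !hornerE.
have prodE l := expectation_prod_horner_gamma11 (p l) X_indep X_gamma.
rewrite unlock; under eq_integral do rewrite expand -sumEFin.
rewrite integral_sum//=; last first.
  move=> l; under eq_fun do rewrite EFinM.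
  by apply: integrableZl => //; exact: (prodE l).2.
rewrite -sumEFin; apply: eq_bigr => l _.
under eq_integral do rewrite EFinM.
rewrite integralZl//; last exact: (prodE l).2.
have := (prodE l).1; rewrite unlock => ->; rewrite -EFinM; congr (_ * _)%:E.
apply: eq_bigr => i _.
by rewrite (derangement_poly_factorial_moment _ _ hd).
Qed.
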